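(* Fix $\alpha\in(0,1)$, $\tau\in(0,1)$ and integers $n,N\ge1$, and suppose the loss $\ell:\widehat{\mathcal Y}\times\mathcal Y\to\{0,1\}$ takes values in $\{0,1\}$. Then the Binomial test $\widehat T_{\mathrm{Binom}}$ (defined in the context) is a black-box test for algorithm evaluation, and it satisfies the assumption-free validity condition $$\mathbb P_P\big(\widehat T_{\mathrm{Binom}}(\mathcal A,\mathcal D_N)=1\big)\le\alpha\quad\text{for any algorithm }\mathcal A\text{ and distribution }P\text{ on }\mathcal X\times\mathcal Y\text{ such that }R_{P,n}(\mathcal A)\ge\tau .$$ Moreover, if $\alpha<(1-\tau)^{\lfloor N/(n+1)\rfloor}$, then for any algorithm $\mathcal A$ and any distribution $P$ with $R_{P,n}(\mathcal A)<\tau$, $$\mathbb P\big(\widehat T_{\mathrm{Binom}}(\mathcal A,\mathcal D_N)=1\big)=\alpha\left(1+\frac{\tau-R_{P,n}(\mathcal A)}{1-\tau}\right)^{\lfloor N/(n+1)\rfloor}\wedge 1 .$$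
   Context: $\mathcal X,\mathcal Y,\widehat{\mathcal Y}$ are measurable spaces; all functions are assumed measurable as appropriate. $a\wedge b=\min(a,b)$; $[n]=\{1,\dots,n\}$. Algorithm: a map $\mathcal A:\bigcup_{m\ge0}(\mathcal X\times\mathcal Y)^m\times[0,1]\to\{\text{measurable functions }\mathcal X\to\widehat{\mathcal Y}\}$, taking a data set (a finite tuple of any size) and a random seed $\xi\in[0,1]$ and returning a fitted model $\mathcal A(\mathcal D;\xi)$; for each $m$ the map $((x_1,y_1),\dots,(x_m,y_m),\xi,x)\mapsto[\mathcal A(\{(x_i,y_i)\}_{i\in[m]};\xi)](x)$ is measurable. Risk: $R_{P,n}(\mathcal A)=\mathbb E[\ell(\hat f_n(X_{n+1}),Y_{n+1})]$ where $\hat f_n=\mathcal A(\{(X_i,Y_i)\}_{i\in[n]};\xi)$, $(X_1,Y_1),\dots,(X_{n+1},Y_{n+1})$ are i.i.d. from $P$, and $\xi\sim\mathrm{Unif}[0,1]$ is independent of them. Data: $\mathcal D_N=\{(X_i,Y_i)\}_{i\in[N]}$ with $(X_i,Y_i)$ i.i.d. from $P$. $\mathbb P_P$ (or $\mathbb P$) is over $\mathcal D_N$ and any randomization in the test. Binomial test: for each batch $j=1,\dots,\lfloor\frac{N}{n+1}\rfloor$ let $\mathcal D^{(j)}=\{(X_i,Y_i)\}_{i=(j-1)(n+1)+1}^{j(n+1)-1}$, $\hat f^{(j)}=\mathcal A(\mathcal D^{(j)};\xi^{(j)})$ with $\xi^{(j)}$ i.i.d. $\mathrm{Unif}[0,1]$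 (independent of the data), and $\ell^{(j)}=\ell(\hat f^{(j)}(X_{j(n+1)}),Y_{j(n+1)})\in\{0,1\}$. Let $S=\sum_{j=1}^{\lfloor N/(n+1)\rfloor}\ell^{(j)}$, and let $\zeta\sim\mathrm{Unif}[0,1]$ be independent of everything else. Define $\widehat T_{\mathrm{Binom}}(\mathcal A,\mathcal D_N)=1$ if $S<k_*$, or if $S=k_*$ and $\zeta\le a_*$; and $=0$ otherwise. Here the nonnegative integer $k_*$ and the value $a_*\in[0,1)$ are the unique values satisfying $$\mathbb P\big(\mathrm{Binomial}(\lfloor\tfrac{N}{n+1}\rfloor,\tau)<k_*\big)+a_*\,\mathbb P\big(\mathrm{Binomial}(\lfloor\tfrac{N}{n+1}\rfloor,\tau)=k_*\big)=\alpha .$$ Black-box test (algorithm evaluation): let $\mathfrak D=\bigcup_{m\ge0}(\mathcal X\times\mathcal Y)^m$. A function $\widehat T$ taking an algorithm $\mathcal A$ and a data set $\mathcal D\in\mathfrak D$ and returning a (possibly randomized) output $\widehat T(\mathcal A,\mathcal D)\in\{0,1\}$ is a black-box test if, for some functions $g^{(1)},g^{(2)},\dots,g$ (not depending on $\mathcal A$) and random seeds $\zeta^{(1)},\zeta^{(2)},\dots,\zeta$ i.i.d. $\mathrm{Unif}[0,1]$ (independent of the data), it is produced as follows. (1) At stage $r=1$, generate a data set in $\mathfrak D$ and a seed in $[0,1]$, $(\mathcal D^{(1)},\xi^{(1)})=g^{(1)}(\mathcal D,\zeta^{(1)})$, and compute $\hat f^{(1)}=\mathcal A(\mathcal D^{(1)};\xi^{(1)})$.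 (2) For each stage $r=2,3,\dots$, generate $(\mathcal D^{(r)},\xi^{(r)})=g^{(r)}\big(\mathcal D,(\mathcal D^{(s)})_{1\le s<r},(\hat f^{(s)})_{1\le s<r},(\zeta^{(s)})_{1\le s\le r},(\xi^{(s)})_{1\le s<r}\big)$ and compute $\hat f^{(r)}=\mathcal A(\mathcal D^{(r)};\xi^{(r)})$. (3) Repeat until some stopping criterion (evaluated on the information generated so far) is reached; $\hat r$ denotes the data-dependent total number of rounds, which is finite. (4) Return $\widehat T(\mathcal A,\mathcal D)=g\big(\mathcal D,(\mathcal D^{(r)})_{1\le r\le\hat r},(\hat f^{(r)})_{1\le r\le\hat r},(\zeta^{(r)})_{1\le r\le\hat r},(\xi^{(r)})_{1\le r\le\hat r},\zeta\big)$. The map $(\mathcal D,\zeta^{(1)},\zeta^{(2)},\dots,\zeta)\mapsto\widehat T(\mathcal A,\mathcal D)$ is assumed measurable. *)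

(* Defs.v *)
From HB Require Import structures.
From mathcomp Require Import all_boot all_order all_algebra finmap.
From mathcomp Require Import interval_inference.
From mathcomp Require Import all_classical all_reals all_analysis.
From mathcomp Require Import measurable_realfun.

Set Implicit Arguments.
Unset Strict Implicit.
Unset Printing Implicit Defensive.

Import Order.TTheory GRing.Theory Num.Theory.
Import numFieldNormedType.Exports.

Local Open Scope classical_set_scope.
Local Open Scope ring_scope.

(* The unit interval [0, 1] with the trace of the Borel sigma-algebra of R. *)
Definition seed (R : realType) : Type := {i01 R}.
HB.instance Definition _ (R : realType) := Choice.copy (seed R) {i01 R}.
HB.instance Definition _ (R : realType) :=
  isPointed.Build (seed R) (0%:i01 : {i01 R}).

Definition seed_val (R : realType) (u : seed R) : R := (u : {i01 R})%:num.

HB.instance Definition _ (R : realType) :=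
  Measurable.copy (seed R) (g_sigma_algebra_preimageType (@seed_val R)).

Section seed_law.
Variable R : realType.

Fact clamp_ge0 (x : R) : 0 <= Num.min (Num.max 0 x) 1.
Proof. by rewrite le_min le_max lexx ler01. Qed.

Fact clamp_le1 (x : R) : Num.min (Num.max 0 x) 1 <= 1.
Proof. by rewrite ge_min lexx orbT. Qed.

(* Identity on [0, 1]; only used to transport the uniform law to [seed R]. *)
Definition to_seed (x : measurableTypeR R) : seed R := Itv01 (clamp_ge0 x) (clamp_le1 x).

Fact measurable_to_seed : measurable_fun setT to_seed.
Proof.
move=> _ A [B mB <-]; rewrite setTI.
pose f (x : R) : R := Num.min (Num.max 0 x) 1.
have mf : measurable_fun [set: R] f.
  rewrite (_ : f = fun x => - Num.max (- Num.max 0 x) (- 1)).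
    by do 2!(apply: measurableT_comp => //; apply: measurable_maxr => //).
  by apply/funext => x; rewrite -oppr_min opprK.
by have := mf measurableT B mB; rewrite !setTI.
Qed.

HB.instance Definition _ :=
  isMeasurableFun.Build _ _ _ _ to_seed measurable_to_seed.

Definition unif_seed : probability (seed R) R :=
  distribution (uniform_prob (@ltr01 R)) to_seed.

End seed_law.

Section iid.
Context {R : realType} {d : measure_display} {T : measurableType d}.

Definition tcons (n : nat) (w : T * n.-tuple T) : n.+1.-tuple T :=
  [tuple of w.1 :: w.2].

Fact measurable_tcons n : measurable_fun setT (@tcons n).
Proof. exact: measurable_cons. Qed.

HB.instance Definition _ n :=
  isMeasurableFun.Build _ _ _ _ (@tcons n) (@measurable_tcons n).

(* The joint law P x ... x P of n i.i.d. draws from P. *)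
Fixpoint iid_law (P : probability T R) (n : nat) : probability (n.-tuple T) R :=
  match n with
  | 0 => dirac ([tuple] : 0.-tuple T)
  | m.+1 => distribution (P \x iid_law P m)%E (@tcons m)
  end.

End iid.

Section algorithms.
Context (R : realType) (dX dY dH : measure_display).
Context (X : measurableType dX) (Y : measurableType dY) (Yh : measurableType dH).

(* A data set is a finite sequence of any length; measurability in the data is
   required separately for each length. *)
Record algorithm := Algorithm {
  fit :> seq (X * Y) -> seed R -> {mfun X >-> Yh};
  measurable_fit : forall m : nat, measurable_fun setT
    (fun w : m.-tuple (X * Y) * seed R * X => fit w.1.1 w.1.2 w.2 : Yh)
}.

Section risk.
Variable loss : {mfun (Yh * Y)%type >-> bool}.

Definition risk (P : probability (X * Y)%type R) (n : nat) (A : algorithm) : R :=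
  fine ('E_((iid_law P n.+1 \x unif_seed R)%E)[fun w =>
    let train := take n w.1 in
    let test := tnth w.1 ord_max in
    (loss (A train w.2 test.1, test.2))%:R]).

End risk.

(** Randomized tests are functions of an algorithm, a data set, an infinite
    sequence of seeds (zeta^(r))_(r >= 1), where zeta^(r) is stored at index
    r - 1, and a final seed zeta. *)
Definition randomized_test : Type :=
  algorithm -> seq (X * Y) -> (nat -> seed R) -> seed R -> bool.

(* Product sigma-algebra on seed sequences. *)
Definition seed_seq : measurableType _ := g_sigma_algebraType
  (\bigcup_(r in [set: nat])
     preimage_set_system setT (fun zs : nat -> seed R => zs r) measurable).

Definition measurable_test (T : randomized_test) : Prop :=
  forall (A : algorithm) (m : nat), measurable_fun setT
    (fun w : m.-tuple (X * Y) * seed_seq * seed R => T A w.1.1 w.1.2 w.2).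

(* The information produced in one round of a black-box test: the data set
   D^(r) and seed xi^(r) submitted to the algorithm, the fitted model, and the
   random seed zeta^(r) of that round. *)
Record round := Round {
  round_data : seq (X * Y);
  round_seed : seed R;
  round_model : {mfun X >-> Yh};
  round_zeta : seed R
}.

(* [query r] is g^(r + 1): it sees the input data, the previous r rounds and
   the current zeta. *)
Definition query_rule : Type :=
  nat -> seq (X * Y) -> seq round -> seed R -> seq (X * Y) * seed R.

Fixpoint rounds (A : algorithm) (query : query_rule) (D : seq (X * Y))
    (zs : nat -> seed R) (r : nat) : seq round :=
  match r with
  | 0 => [::]
  | s.+1 => let past := rounds A query D zs s in
            let q := query s D past (zs s) in
            rcons past (Round q.1 q.2 (A q.1 q.2) (zs s))
  end.

(* At least one round is run, and the stopping criterion [stop] is evaluated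
   after each completed round; [query], [stop] and [output] access the
   algorithm only through the rounds. *)
Definition black_box_test (T : randomized_test) : Prop :=
  (exists (query : query_rule) (stop : seq (X * Y) -> seq round -> bool)
      (output : seq (X * Y) -> seq round -> seed R -> bool),
    forall (A : algorithm) (D : seq (X * Y)) (zs : nat -> seed R) (z : seed R),
    exists rhat : nat,
      [/\ (0 < rhat)%N,
          stop D (rounds A query D zs rhat),
          forall r, (0 < r < rhat)%N -> ~~ stop D (rounds A query D zs r)
        & T A D zs z = output D (rounds A query D zs rhat) z])
  /\ measurable_test T.

End algorithms.

Section sampling.
Context {R : realType} {d : measure_display} {Omega : measurableType d}.
Variable Pr : probability Omega R.

Definition mutually_independent (I : choiceType) (F : I -> set (set Omega)) :=
  forall (J : {fset I}) (E : I -> set Omega),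
    (forall i, i \in J -> F i (E i)) ->
    Pr (\bigcap_(i in [set` J]) E i) = (\prod_(i <- J) Pr (E i))%E.

Section sampling_model.
Context {dT : measure_display} {T : measurableType dT} (P : probability T R).
Context (N : nat) (Z : 'I_N -> {RV Pr >-> T}).
Context (zs : nat -> {RV Pr >-> seed R}) (z : {RV Pr >-> seed R}).

(* The sigma-algebras generated by the data points and by all the seeds. *)
Definition sources (i : 'I_N + option nat) : set (set Omega) :=
  match i with
  | inl k => g_sigma_algebra_preimage (Z k)
  | inr (Some r) => g_sigma_algebra_preimage (zs r)
  | inr None => g_sigma_algebra_preimage z
  end.

Record sampling_model : Prop := SamplingModel {
  data_law : forall i B, measurable B -> distribution Pr (Z i) B = P B;
  seeds_law : forall r B, measurable B ->
    distribution Pr (zs r) B = unif_seed R B;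
  final_seed_law : forall B, measurable B ->
    distribution Pr z B = unif_seed R B;
  sources_independent : mutually_independent sources
}.

End sampling_model.
End sampling.

Section validity.
Context (R : realType) (dX dY dH : measure_display).
Context (X : measurableType dX) (Y : measurableType dY) (Yh : measurableType dH).

Definition rejection_prob {dO : measure_display} {Omega : measurableType dO}
    (Pr : probability Omega R) (T : randomized_test R X Y Yh)
    (A : algorithm R X Y Yh) (N : nat)
    (Z : 'I_N -> {RV Pr >-> (X * Y)%type})
    (zs : nat -> {RV Pr >-> seed R}) (z : {RV Pr >-> seed R}) : \bar R :=
  Pr [set w | T A [tuple Z i w | i < N] (fun r => zs r w) (z w) = true].

Definition valid_test (loss : {mfun (Yh * Y)%type >-> bool}) (alpha tau : R) (n N : nat)
    (T : randomized_test R X Y Yh) : Prop :=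
  forall (A : algorithm R X Y Yh) (P : probability (X * Y)%type R),
    tau <= risk loss P n A ->
  forall (dO : measure_display) (Omega : measurableType dO)
    (Pr : probability Omega R) (Z : 'I_N -> {RV Pr >-> (X * Y)%type})
    (zs : nat -> {RV Pr >-> seed R}) (z : {RV Pr >-> seed R}),
    sampling_model P Z zs z ->
    (rejection_prob T A Z zs z <= alpha%:E)%E.

End validity.

Section binomial_test.
Variable R : realType.

(* Both components are uniquely determined, see [binom_cutoff_spec] and
   [binom_cutoff_uniq]. *)
Definition is_binom_cutoff (alpha tau : R) (m : nat) (ka : nat * R) : Prop :=
  0 <= ka.2 < 1 /\
  (binomial_prob m tau [set k : nat | (k < ka.1)%N]
   + ka.2%:E * binomial_prob m tau [set ka.1] = alpha%:E)%E.

Definition binom_cutoff (alpha tau : R) (m : nat) : nat * R :=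
  xget (0%N, 0) [set ka | is_binom_cutoff alpha tau m ka].

Section binom_cutoff_spec.
Variables (alpha tau : R) (m : nat).
Hypotheses (al01 : 0 < alpha < 1) (t01 : 0 < tau < 1).

Let p := binomial_pmf m tau.
Let F (i : nat) := \sum_(k < i) p k.

Let tau_ge0le1 : 0 <= tau <= 1.
Proof. by case/andP: t01 => t0 t1; rewrite !ltW. Qed.

Let p_ge0 i : 0 <= p i.
Proof. exact: binomial_pmf_ge0. Qed.

Let p_gt0 i : (i <= m)%N -> 0 < p i.
Proof.
case/andP: t01 => t0 t1 im; rewrite /p /binomial_pmf pmulrn_lgt0 ?bin_gt0//.
by rewrite mulr_gt0 // exprn_gt0 // subr_gt0.
Qed.

Let F_le i j : (i <= j)%N -> F i <= F j.
Proof.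
move=> ij; rewrite /F -!(big_mkord xpredT p) (@big_cat_nat _ _ _ i 0 j)//=.
by rewrite lerDl sumr_ge0.
Qed.

Let F_full : F m.+1 = 1.
Proof.
rewrite /F /p -(expr1n R m) -[X in X ^+ m](subrK tau 1) exprDn.
by apply: eq_bigr => i _; rewrite /binomial_pmf mulrC.
Qed.

Let is_cutoffE ka : is_binom_cutoff alpha tau m ka <->
  0 <= ka.2 < 1 /\ F ka.1 + ka.2 * p ka.1 = alpha.
Proof.
case: ka => K a; rewrite /is_binom_cutoff /= /binomial_prob tau_ge0le1.
rewrite esum_set1 ?lee_fin//.
rewrite esum_fset; [|exact: finite_II|by move=> i _; rewrite lee_fin p_ge0].
rewrite -fsbig_ord//= sumEFin -EFinM -EFinD.
by split=> -[a01 H]; split=> //; [case: H|rewrite -[in RHS]H].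
Qed.

Let bracket i c : 0 <= c < 1 -> F i + c * p i = alpha -> F i <= alpha < F i.+1.
Proof.
move=> /andP[c0 c1] E; rewrite {2}/F big_ord_recr/= -/(F i) -E lerDl.
rewrite mulr_ge0//= ltrD2l gtr_pMl// p_gt0// leqNgt; apply/negP => mi.
have := F_le mi; rewrite F_full leNgt => /negP; apply.
by case/andP: al01 => _; apply: le_lt_trans; rewrite -E lerDl mulr_ge0.
Qed.

Lemma binom_cutoff_uniq ka kb : is_binom_cutoff alpha tau m ka ->
  is_binom_cutoff alpha tau m kb -> ka = kb.
Proof.
case: ka kb => [k a] [l b] /is_cutoffE[/= a01 Ea] /is_cutoffE[/= b01 Eb].
have /andP[ka ak] := bracket a01 Ea; have /andP[lb bl] := bracket b01 Eb.
have kl : k = l.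
  apply/eqP; rewrite eqn_leq; apply/andP; split; rewrite leqNgt; apply/negP.
    by move=> /F_le /(lt_le_trans bl)/lt_le_trans/(_ ka); rewrite ltxx.
  by move=> /F_le /(lt_le_trans ak)/lt_le_trans/(_ lb); rewrite ltxx.
subst l; congr (_, _); apply: (@mulIf _ (p k)).
  apply: contraTneq ak => pk0.
  by rewrite /F big_ord_recr/= -/(F k) pk0 addr0 -leNgt.
by apply: (@addrI _ (F k)); rewrite Ea Eb.
Qed.

Lemma binom_cutoff_spec :
  is_binom_cutoff alpha tau m (binom_cutoff alpha tau m).
Proof.
rewrite /binom_cutoff; case: xgetP => [ka -> //|none]; exfalso.
case/andP: al01 => al0 al1.
have ex : exists i, F i <= alpha by exists 0%N; rewrite /F big_ord0 ltW.
have bnd i : F i <= alpha -> (i <= m)%N.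
  move=> Fi; rewrite leqNgt; apply/negP => /F_le.
  by rewrite F_full => /le_trans/(_ Fi); rewrite leNgt al1.
case: (ex_maxnP ex bnd) => k Fk kmax.
have pk : 0 < p k by rewrite p_gt0// bnd.
apply: (none (k, (alpha - F k) / p k)); apply/is_cutoffE => /=; split.
  rewrite divr_ge0 ?subr_ge0 ?(ltW pk)//= ltr_pdivrMr// mul1r ltrBlDl.
  rewrite ltNge; apply/negP => Fk1.
  have := kmax k.+1; rewrite /F big_ord_recr/= -/(F k) ltnn.
  by move=> /(_ Fk1).
by rewrite divfK ?gt_eqF// addrC subrK.
Qed.

End binom_cutoff_spec.

Context (dX dY dH : measure_display).
Context (X : measurableType dX) (Y : measurableType dY) (Yh : measurableType dH).

Section batches.
Context (loss : {mfun (Yh * Y)%type >-> bool}) (n : nat) (A : algorithm R X Y Yh).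

(* Loss on the j-th batch of n + 1 consecutive points of D, with j counted from
   0; the default value [point] is irrelevant for j < size D %/ n.+1. *)
Definition batch_loss (D : seq (X * Y)) (xi : seed R) (j : nat) : bool :=
  let train := take n (drop (j * n.+1) D) in
  let test := nth point D (j * n.+1 + n) in
  loss (A train xi test.1, test.2).

End batches.

(* With N = size D; the seed xi^(j) of the j-th batch is zeta^(j). *)
Definition binom_test (loss : {mfun (Yh * Y)%type >-> bool}) (alpha tau : R) (n : nat) :
    randomized_test R X Y Yh := fun A D zs z =>
  let m := (size D %/ n.+1)%N in
  let s := (\sum_(j < m) batch_loss loss n A D (zs j) j)%N in
  let: (k, a) := binom_cutoff alpha tau m in
  (s < k)%N || (s == k) && (seed_val z <= a).

End binomial_test.

(* Main.v *)
Require Import Defs.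
From HB Require Import structures.
From mathcomp Require Import all_boot all_order all_algebra finmap.
From mathcomp Require Import all_classical all_reals all_analysis.
From mathcomp Require Import measurable_realfun ring.

Set Implicit Arguments.
Unset Strict Implicit.
Unset Printing Implicit Defensive.

Import Order.TTheory GRing.Theory Num.Theory.
Local Open Scope classical_set_scope.
Local Open Scope ring_scope.

(** Each batch is a fresh sample of n + 1 points with a fresh seed, so its
    holdout loss is a Bernoulli variable whose parameter is exactly the risk r
    of the algorithm, and the losses of different batches, together with the
    final seed, are independent. Hence S is Binomial(m, r) with
    m = N %/ (n + 1), and the test rejects with probability
      G(r) = P(Bin(m, r) < k) + a * P(Bin(m, r) = k),
    where (k, a) is the cutoff, chosen so that G(tau) = alpha
    ([rejection_probE]).

    Validity is then the fact that G is nonincreasing: it is a convex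
    combination of two binomial distribution functions at fixed points, and
    these decrease in the success probability by induction on the number of
    trials ([binomial_cdf_nonincreasing]). When alpha < (1 - tau) ^ m, the
    cutoff is k = 0 with a = alpha / (1 - tau) ^ m, so that
    G(r) = a * (1 - r) ^ m = alpha * ((1 - r) / (1 - tau)) ^ m, a product of
    two numbers of [0, 1], which makes the minimum with 1 harmless.

    The probabilistic work is to pass from the independence of the elementary
    sources of randomness (data points and seeds) to that of whole batches.
    An event is called independent of a set K of sources ([indep_event]) when
    it factors out of every rectangle built on sources of K. A random element
    computed from the sources in B then keeps its law mu against every event
    independent of B ([indep_law]); this passes to pairs by uniqueness of the
    product measure ([indep_law_pair]), hence to tuples. Batches are consumed
    one after the other: after j batches, the event S = k is still independent
    of all sources that have not been used, so the next loss multiplies its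
    probability by r or 1 - r, which is Pascal's recursion for the binomial
    probabilities ([indep_count_eq]).

    The test is black-box because its r-th query is the r-th training batch,
    whatever happened before; one round is run even when there is no complete
    batch. *)

(** * Binomial distribution functions *)

Section randomized_binomial_cdf.
Variable R : realType.
Implicit Types (p q a : R) (m k : nat).

Lemma binomial_pmf0 m p : binomial_pmf m p 0 = (1 - p) ^+ m.
Proof. by rewrite /binomial_pmf expr0 mul1r subn0 bin0 mulr1n. Qed.

Lemma binomial_pmf0S k p : binomial_pmf 0 p k.+1 = 0.
Proof. by rewrite /binomial_pmf bin0n. Qed.

Lemma binomial_pmfS m p k :
  binomial_pmf m.+1 p k.+1 =
  p * binomial_pmf m p k + (1 - p) * binomial_pmf m p k.+1.
Proof.
rewrite /binomial_pmf /unstable.onem binS subSS mulrnDr exprS.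
have [mk|km] := ltnP k m; last by rewrite bin_small// !mulr0n; ring.
rewrite -(subnSK mk) exprS.
ring.
Qed.

(** The inequality is strict, as in the condition S < k of the test, so that the
    value at [0] vanishes. *)
Definition binomial_cdf m p k : R := \sum_(i < k) binomial_pmf m p i.

Lemma binomial_cdf0 m p : binomial_cdf m p 0 = 0.
Proof. by rewrite /binomial_cdf big_ord0. Qed.

Lemma binomial_cdfS m p k :
  binomial_cdf m.+1 p k.+1 =
  p * binomial_cdf m p k + (1 - p) * binomial_cdf m p k.+1.
Proof.
rewrite /binomial_cdf big_ord_recl [in RHS]big_ord_recl !binomial_pmf0.
under eq_bigr do rewrite lift0 binomial_pmfS.
rewrite big_split -!mulr_sumr mulrDr -exprS addrCA.
by congr (_ + (_ + _ * _)); apply: eq_bigr => i _; rewrite lift0.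
Qed.

(** By conditioning on the first trial, F_(m+1)(k+1) is the average of
    F_m(k) and F_m(k+1) with weights p and 1 - p. As F_m(k) <= F_m(k+1), a
    larger p favours the smaller of the two, and both of them decrease by
    induction. *)
Lemma binomial_cdf_nonincreasing m k p q : 0 <= p -> p <= q -> q <= 1 ->
  binomial_cdf m q k <= binomial_cdf m p k.
Proof.
move=> p0 pq q1; elim: m k => [|m IH] [|k]; rewrite ?binomial_cdf0//.
  rewrite /binomial_cdf !big_ord_recl !binomial_pmf0 !expr0.
  by rewrite !big1// => i _; rewrite lift0 binomial_pmf0S.
have step : binomial_cdf m p k <= binomial_cdf m p k.+1.
  rewrite /binomial_cdf [leRHS]big_ord_recr/= lerDl binomial_pmf_ge0//.
  by rewrite p0 (le_trans pq).
rewrite !binomial_cdfS.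
(* First replace q by p inside the averaged terms, then in the weights. *)
apply: (@le_trans _ _
    (q * binomial_cdf m p k + (1 - q) * binomial_cdf m p k.+1)).
  by rewrite lerD// ler_wpM2l// ?subr_ge0// (le_trans p0).
rewrite -subr_ge0 [leRHS](_ : _ =
    (q - p) * (binomial_cdf m p k.+1 - binomial_cdf m p k)); last by ring.
by rewrite mulr_ge0 ?subr_ge0.
Qed.

(** The rejection probability of the randomized cutoff [ka] when the number of
    losses is binomial with parameters [m] and [p]. *)
Definition rejection_level m p (ka : nat * R) : R :=
  binomial_cdf m p ka.1 + ka.2 * binomial_pmf m p ka.1.

Lemma rejection_level_nonincreasing m ka p q : 0 <= ka.2 < 1 ->
  0 <= p -> p <= q -> q <= 1 ->
  rejection_level m q ka <= rejection_level m p ka.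
Proof.
case: ka => k a /= /andP[a0 a1] p0 pq q1.
have E x : rejection_level m x (k, a) =
    (1 - a) * binomial_cdf m x k + a * binomial_cdf m x k.+1.
  by rewrite /rejection_level /binomial_cdf/= big_ord_recr/=; ring.
by rewrite !E lerD// ler_wpM2l ?subr_ge0 ?binomial_cdf_nonincreasing// ltW.
Qed.

Lemma is_binom_cutoffE alpha tau m ka : 0 <= tau <= 1 ->
  is_binom_cutoff alpha tau m ka <->
  0 <= ka.2 < 1 /\ rejection_level m tau ka = alpha.
Proof.
move=> t01; rewrite /is_binom_cutoff /binomial_prob t01.
have p0 i : 0 <= binomial_pmf m tau i by exact: binomial_pmf_ge0.
rewrite esum_set1 ?lee_fin//.
rewrite esum_fset; [|exact: finite_II|by move=> i _; rewrite lee_fin].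
rewrite -fsbig_ord//= sumEFin -EFinM -EFinD.
by split=> -[a01 H]; split=> //; [case: H|rewrite -[in RHS]H].
Qed.

End randomized_binomial_cdf.

(** * Events and laws independent of a set of sources *)

Section independent_sources.
Context {R : realType} {d : measure_display} {Omega : measurableType d}.
Variable Pr : probability Omega R.
Variables (I : choiceType) (F : I -> set (set Omega)).
Hypothesis mF : forall i, F i `<=` measurable.
Local Open Scope ereal_scope.

(** Only rectangles, with one event per source, are tested: this is what mutual
    independence of the sources provides, and it is stable enough to remove the
    sources of [K] one at a time. *)
Definition indep_event (K : set I) (E : set Omega) : Prop :=
  measurable E /\
  forall (s : seq I) (G : I -> set Omega), uniq s -> [set` s] `<=` K ->
    (forall i, i \in s -> F i (G i)) ->
    Pr (E `&` \bigcap_(i in [set` s]) G i) = Pr E * \prod_(i <- s) Pr (G i).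

(** [U] is meant to be computed from the sources in [B]. Quantifying over all
    events independent of [B], instead of stating independence from given
    random elements, lets the notion be used along a sequence of conditionings
    without ever forming a joint law. *)
Definition indep_law d' (T : measurableType d') (B : set I) (U : Omega -> T)
    (mu : set T -> \bar R) : Prop :=
  measurable_fun setT U /\
  forall E, indep_event B E -> forall C, measurable C ->
    Pr (E `&` U @^-1` C) = Pr E * mu C.

Lemma indep_eventT : mutually_independent Pr F -> indep_event setT setT.
Proof.
move=> indF; split=> // s G us _ sG; rewrite setTI probability_setT mul1e.
pose J := [fset i in s]%fset.
have Js : perm_eq J s.
  by apply: uniq_perm => // i; rewrite in_fset.
have Jset : [set` s] = [set` J].
  by apply/seteqP; split=> i /=; rewrite in_fset.
rewrite Jset indF; last by move=> i; rewrite in_fset => /sG.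
exact: perm_big.
Qed.

Lemma indep_eventS K K' E : K' `<=` K -> indep_event K E -> indep_event K' E.
Proof.
by move=> K'K [mE indE]; split=> // s G us /subset_trans/(_ K'K); exact: indE.
Qed.

Let measurable_sources (s : seq I) (G : I -> set Omega) :
  (forall i, i \in s -> F i (G i)) ->
  measurable (\bigcap_(i in [set` s]) G i).
Proof.
move=> sG; apply: fin_bigcap_measurable; first exact: finite_seq.
by move=> i /= /sG/mF.
Qed.

Let bigcap_cons i (s : seq I) (G : I -> set Omega) :
  \bigcap_(j in [set` i :: s]) G j = G i `&` \bigcap_(j in [set` s]) G j.
Proof.
apply/seteqP; split=> [w Gw|w [Gi Gs] j /=].
  by split=> [|j js]; apply: Gw; rewrite /= inE ?eqxx// js orbT.
by rewrite inE => /predU1P[->//|]; exact: Gs.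
Qed.

Let Pr_fin (A : set Omega) : measurable A -> Pr A < +oo.
Proof. by move=> mA; rewrite ltey_eq fin_num_measure. Qed.

Let PrU (A B : set Omega) : measurable A -> measurable B -> A `&` B = set0 ->
  Pr (A `|` B) = Pr A + Pr B.
Proof. exact: measureU. Qed.

Let PrD (A B : set Omega) : measurable A -> measurable B -> B `<=` A ->
  Pr (A `\` B) = Pr A - Pr B.
Proof.
move=> mA mB BA; rewrite -[in RHS](setDUK BA) PrU//; last 2 first.
- exact: measurableD.
- by rewrite setDIK.
by rewrite addeAC subee ?add0e// fin_num_measure.
Qed.

Lemma indep_eventU K E E' : E `&` E' = set0 ->
  indep_event K E -> indep_event K E' -> indep_event K (E `|` E').
Proof.
move=> dis [mE indE] [mE' indE'].
split=> [|s G us sK sG]; first exact: measurableU.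
have mG := measurable_sources sG.
rewrite setIUl !PrU ?indE ?indE' ?ge0_muleDl//; try exact: measurableI.
by rewrite setIACA dis set0I.
Qed.

Lemma indep_eventD K E E' : E' `<=` E ->
  indep_event K E -> indep_event K E' -> indep_event K (E `\` E').
Proof.
move=> E'E [mE indE] [mE' indE'].
split=> [|s G us sK sG]; first exact: measurableD.
have mG := measurable_sources sG.
rewrite (_ : _ `&` _ = (E `&` \bigcap_(i in [set` s]) G i) `\`
    (E' `&` \bigcap_(i in [set` s]) G i)); last first.
  apply/seteqP; split=> w.
    by move=> [[Ew nE'] Gw]; split=> // -[].
  by move=> [[Ew Gw] nE']; split=> //; split=> // E'w; apply: nE'.
rewrite !PrD ?indE ?indE' ?muleBl ?fin_num_measure//.
- rewrite big_seq; apply: (big_ind (fun x => x \is a fin_num)) => //.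
    exact: fin_numM.
  by move=> i /sG/mF mGi; rewrite fin_num_measure.
- by rewrite fin_num_adde_defr// fin_num_measure.
- exact: measurableI.
- exact: measurableI.
- exact: setSI.
Qed.

Lemma indep_eventI_source K E i A : K i -> F i A -> indep_event K E ->
  indep_event (K `\ i) (E `&` A) /\ Pr (E `&` A) = Pr E * Pr A.
Proof.
move=> Ki FA [mE indE].
have PEA : Pr (E `&` A) = Pr E * Pr A.
  have := indE [:: i] (fun=> A); rewrite big_seq1 set_cons1 bigcap_set1.
  apply=> //.
  - by move=> j ->.
  - by move=> j; rewrite inE => /eqP ->.
split=> //; split=> [|s G us sK sG].
  by apply: measurableI => //; exact: mF FA.
have si : i \notin s by apply/negP => /sK[_]; exact.
pose G' j := if j == i then A else G j.
have G'i : G' i = A by rewrite /G' eqxx.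
have G'j j : j \in s -> G' j = G j.
  by move=> js; rewrite /G' ifN//; apply: contraNneq si => <-.
have capG :
    \bigcap_(j in [set` i :: s]) G' j = A `&` \bigcap_(j in [set` s]) G j.
  by rewrite bigcap_cons G'i; congr (_ `&` _); apply: eq_bigcapr => j /= /G'j.
have prodG : \prod_(j <- i :: s) Pr (G' j) = Pr A * \prod_(j <- s) Pr (G j).
  by rewrite big_cons G'i; congr (_ * _); apply: eq_big_seq => j /= /G'j ->.
rewrite PEA -muleA -prodG -setIA -capG indE//= ?si//.
- by move=> j /=; rewrite inE => /predU1P[->//|/sK[]].
- by move=> j; rewrite inE => /predU1P[->|js]; rewrite ?G'i ?G'j//; exact: sG.
Qed.

(** Removing the sources used by [U] restores independence: conditioning first
    on a rectangle of the remaining sources leaves an event independent of [B],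
    to which the law of [U] applies. *)
Lemma indep_eventI d' (T : measurableType d') (U : Omega -> T) mu B K E C :
  indep_law B U mu -> B `<=` K -> measurable C -> indep_event K E ->
  indep_event (K `\` B) (E `&` U @^-1` C).
Proof.
move=> [mU lawU] BK mC indE; have [mE _] := indE.
have mUC : measurable (U @^-1` C).
  by rewrite -[X in measurable X]setTI; exact: mU.
split=> [|s]; first exact: measurableI.
elim: s K E BK indE {mE} => [|i s IH] K E BK indE G us sK sG.
  by rewrite set_nil bigcap_set0 setIT big_nil mule1.
have /andP[si us'] := us.
have [Ki nBi] : (K `\` B) i by apply: sK => /=; rewrite inE eqxx.
have FGi : F i (G i) by apply: sG; rewrite inE eqxx.
have [indE' PE'] := indep_eventI_source Ki FGi indE.
have BK' : B `<=` K `\ i.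
  by move=> j Bj; split; [exact: BK|move=> ji; apply: nBi; rewrite -ji].
rewrite bigcap_cons big_cons setIACA setIA.
rewrite (IH _ _ BK' indE' G us'); last 2 first.
- move=> j /= js; have [Kj nBj] : (K `\` B) j.
    by apply: sK; rewrite /= inE js orbT.
  by split=> //; split=> //= ji; move: si; rewrite -ji js.
- by move=> j js; apply: sG; rewrite inE js orbT.
rewrite (lawU _ (indep_eventS BK' indE')) // (lawU _ (indep_eventS BK indE))//.
by rewrite PE' -!muleA; congr (_ * _); rewrite muleCA.
Qed.

Lemma indep_lawS d' (T : measurableType d') (U : Omega -> T) mu B B' :
  B `<=` B' -> indep_law B U mu -> indep_law B' U mu.
Proof.
move=> BB' [mU lawU]; split=> // E indE C mC; apply: lawU => //.
exact: indep_eventS indE.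
Qed.

Lemma indep_law_source d' (T : measurableType d') (U : {RV Pr >-> T})
    (mu : set T -> \bar R) i :
  F i = g_sigma_algebra_preimage U ->
  (forall C, measurable C -> distribution Pr U C = mu C) ->
  indep_law [set i] U mu.
Proof.
move=> Fi lawU; split=> // E indE C mC.
have FC : F i (U @^-1` C) by rewrite Fi; exists C => //; rewrite setTI.
by have [_ ->] := indep_eventI_source (erefl i) FC indE; rewrite -lawU.
Qed.

Lemma indep_law_comp d1 d2 (T1 : measurableType d1) (T2 : measurableType d2)
    (U : Omega -> T1) (mu : probability T1 R) B (f : {mfun T1 >-> T2}) :
  indep_law B U mu -> indep_law B (f \o U) (distribution mu f).
Proof.
move=> [mU lawU]; split=> [|E indE C mC]; first exact: measurableT_comp.
rewrite comp_preimage lawU// -[X in measurable X]setTI.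
exact: (measurable_funPT f).
Qed.

(** On measurable rectangles, apply the law of [U] against [E], then the law of
    [V] against the part of [E] cut out by [U], which is still independent of
    [B2]. This identifies two finite measures on a generating family that is
    stable under intersection. *)
Lemma indep_law_pair d1 d2 (T1 : measurableType d1) (T2 : measurableType d2)
    (U : Omega -> T1) (V : Omega -> T2)
    (mu : probability T1 R) (nu : probability T2 R) B1 B2 :
  B1 `&` B2 = set0 -> indep_law B1 U mu -> indep_law B2 V nu ->
  indep_law (B1 `|` B2) (fun w => (U w, V w)) (mu \x nu).
Proof.
move=> B12 lU lV; have [mU lawU] := lU; have [mV lawV] := lV.
have mUV : measurable_fun setT (fun w => (U w, V w)).
  exact: measurable_fun_pair.
split=> // E indE C mC; have [mE _] := indE.
pose c : {nonneg R} := NngNum (fine_ge0 (measure_ge0 Pr E)).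
pose m1 : {measure set (T1 * T2)%type -> \bar R} :=
  pushforward (mrestr Pr mE) (fun w => (U w, V w)).
pose m2 : {measure set (T1 * T2)%type -> \bar R} := mscale c (mu \x nu).
suff : m1 mUV C = m2 C.
  rewrite /m1 /m2 /= /pushforward /mrestr /mscale/= fineK ?fin_num_measure//.
  by rewrite setIC.
apply: (measure_unique
  [set A `*` B | A in measurable & B in measurable] (fun=> setT)).
- by rewrite measurable_prod_measurableType.
- move=> _ _ [A1 mA1 [A2 mA2 <-]] [A3 mA3 [A4 mA4 <-]]; rewrite -setXI.
  exists (A1 `&` A3); first exact: measurableI.
  by exists (A2 `&` A4) => //; exact: measurableI.
- by move=> _; exists setT => //; exists setT => //; rewrite setXTT.
- by rewrite bigcup_const//; exists 0%N.
- move=> _ [A1 mA1 [A2 mA2 <-]].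
  rewrite /m1 /m2 /= /pushforward /mrestr /mscale/= fineK ?fin_num_measure//.
  rewrite product_measure1E//= muleA.
  rewrite (_ : _ `&` E = E `&` U @^-1` A1 `&` V @^-1` A2); last first.
    by rewrite -setIA [LHS]setIC.
  have indE1 : indep_event B2 (E `&` U @^-1` A1).
    apply: indep_eventS (indep_eventI lU _ mA1 indE); last exact: subsetUl.
    by move=> i B2i; split; [right|move=> B1i; rewrite -[False]/(set0 i) -B12].
  rewrite lawV// lawU//; apply: indep_eventS indE; exact: subsetUl.
- move=> _; rewrite /m1 /= /pushforward /mrestr preimage_setT setTI.
  exact: Pr_fin.
- exact: mC.
Qed.

Lemma indep_law_tuple d' (T : measurableType d') (P : probability T R) k
    (U : 'I_k -> Omega -> T) (B : 'I_k -> set I) :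
  trivIset setT B -> (forall i, indep_law (B i) (U i) P) ->
  indep_law (\bigcup_i B i) (fun w => [tuple U i w | i < k]) (iid_law P k).
Proof.
elim: k U B => [|k IH] U B tB lU.
  split=> [|E indE C mC]; first by apply/measurable_fun_tnthP; case.
  rewrite /= diracE; have [C0|C0] := boolP (_ \in C).
    rewrite mule1; congr (Pr _); apply/seteqP; split=> [w []//|w Ew].
    by split=> //=; rewrite [X in C X]tuple0; exact: set_mem.
  rewrite mule0 (_ : _ `&` _ = set0) ?measure0//.
  apply/seteqP; split=> // w [_] /=.
  by rewrite [X in C X]tuple0 => /mem_set; rewrite (negbTE C0).
have -> : (fun w => [tuple U i w | i < k.+1]) =
    @tcons d' T k \o (fun w => (U ord0 w, [tuple U (lift ord0 i) w | i < k])).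
  apply/funext => w; apply/val_inj => /=.
  by rewrite enum_ordSl/= -map_comp.
have -> : \bigcup_i B i = B ord0 `|` \bigcup_i B (lift ord0 i).
  apply/seteqP; split=> [j [i _ Bj]|j [Bj|[i _ Bj]]];
    [|by exists ord0|by exists (lift ord0 i)].
  by case: (unliftP ord0 i) Bj => [i' ->|-> Bj]; [right; exists i'|left].
apply: indep_law_comp; apply: indep_law_pair => //.
  rewrite -subset0 => j [B0 [i _ Bi]].
  have /eqP : ord0 = lift ord0 i by apply: tB => //; exists j.
  by rewrite (negbTE (neq_lift _ _)).
apply: IH => [i j _ _ ij|//].
by apply: (@lift_inj _ ord0); apply: tB.
Qed.

(** * Counting losses one batch at a time *)

(** [K j] stands for the sources that are still unused after [j] trials. *)
Section binomial_count.
Variables (r : R) (m : nat) (K : nat -> set I) (L : nat -> Omega -> bool).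
Hypothesis indepK : indep_event (K 0%N) setT.
Hypothesis decK : forall j, (j < m)%N -> K j.+1 `<=` K j.
Hypothesis indepL : forall j E, (j < m)%N -> indep_event (K j) E ->
  indep_event (K j.+1) (E `&` [set w | L j w]) /\
  Pr (E `&` [set w | L j w]) = Pr E * r%:E.

Let S j w := (\sum_(i < j) L i w)%N.

(** S_(j+1) = k+1 when S_j = k and trial [j] is a loss, or S_j = k+1 and it is
    not; the two events have probabilities r * p_j(k) and (1 - r) * p_j(k+1),
    whose sum is p_(j+1)(k+1) by Pascal's rule. Carrying the independence from
    [K j] along makes the induction go through. *)
Lemma indep_count_eq j k : (j <= m)%N ->
  indep_event (K j) [set w | S j w = k] /\
  Pr [set w | S j w = k] = (binomial_pmf j r k)%:E.
Proof.
elim: j k => [|j IH] k jm.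
  case: k => [|k].
    rewrite (_ : [set w | _] = setT); last first.
      by apply/seteqP; split=> // w _; rewrite /S /= big_ord0.
    by rewrite probability_setT binomial_pmf0 expr0.
  rewrite (_ : [set w | _] = setT `\` setT); last first.
    by rewrite setDv; apply/seteqP; split=> // w; rewrite /S /= big_ord0.
  by split; [exact: indep_eventD|rewrite setDv measure0 binomial_pmf0S].
have jm' := ltnW jm; have KS := decK jm.
pose E l := [set w | S j w = l]; pose EL l := E l `&` [set w | L j w].
have indE l : indep_event (K j.+1) (E l).
  exact: indep_eventS KS (IH l jm').1.
have indEL l : indep_event (K j.+1) (EL l) := (indepL jm (IH l jm').1).1.
have PEL l : Pr (EL l) = (r * binomial_pmf j r l)%:E.
  by rewrite (indepL jm (IH l jm').1).2 (IH l jm').2 -EFinM mulrC.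
have PED l : Pr (E l `\` EL l) = ((1 - r) * binomial_pmf j r l)%:E.
  rewrite PrD; [|exact: (indE l).1|exact: (indEL l).1|exact: subIsetl].
  by rewrite PEL (IH l jm').2 -EFinB mulrBl mul1r.
case: k => [|k].
  rewrite (_ : [set w | _] = E 0%N `\` EL 0%N).
    split; first by apply: indep_eventD => //; exact: subIsetl.
    by rewrite PED !binomial_pmf0 exprS.
  apply/seteqP; split=> w; rewrite /E /EL /S /= big_ord_recr/=.
    by case: (L j w); rewrite ?addn1 ?addn0// => ->; split=> // -[].
  by case: (L j w) => -[Sj nL] //; [exfalso; apply: nL|rewrite Sj].
rewrite (_ : [set w | _] = EL k `|` (E k.+1 `\` EL k.+1)).
  have dis : EL k `&` (E k.+1 `\` EL k.+1) = set0.
    rewrite -subset0 => w [[Ek _] [Ek1 _]].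
    by have := n_Sn k; rewrite -[in LHS]Ek -Ek1.
  have indD : indep_event (K j.+1) (E k.+1 `\` EL k.+1).
    by apply: indep_eventD => //; exact: subIsetl.
  split; first exact: indep_eventU.
  rewrite PrU//; [|exact: (indEL k).1|exact: indD.1].
  by rewrite PEL PED -EFinD -binomial_pmfS.
apply/seteqP; split=> w; rewrite /E /EL /S /= big_ord_recr/=.
  case: (L j w); rewrite ?addn1 ?addn0.
    by case=> Sk; left; split.
  by move=> ->; right; split=> // -[].
move=> [[Sk ->]|[Sk nL]]; first by rewrite addn1; congr _.+1.
by case: (L j w) nL => nL; [exfalso; apply: nL; split|rewrite addn0].
Qed.

Lemma prob_count_lt k :
  measurable [set w | (S m w < k)%N] /\
  Pr [set w | (S m w < k)%N] = (binomial_cdf m r k)%:E.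
Proof.
elim: k => [|k [mS PS]].
  rewrite (_ : [set w | _] = set0); last by apply/seteqP; split.
  by rewrite measure0 binomial_cdf0.
have [[mE _] PE] := indep_count_eq k (leqnn m).
rewrite (_ : [set w | _] = [set w | (S m w < k)%N] `|` [set w | S m w = k]).
  split; first exact: measurableU.
  rewrite PrU// ?PS ?PE -?EFinD /binomial_cdf ?big_ord_recr//.
  by rewrite -subset0 => w /= [+ Sk]; rewrite Sk ltnn.
apply/seteqP; split=> w /=; rewrite ltnS (leq_eqVlt (S m w)).
  by move=> /predU1P[]; [right|left].
by move=> [->|->]; rewrite ?orbT ?eqxx.
Qed.

End binomial_count.

End independent_sources.

(** * The uniform seed and the holdout loss of one batch *)

Lemma unif_seed_le (R : realType) (a : R) : 0 <= a < 1 ->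
  unif_seed R [set u | seed_val u <= a] = a%:E.
Proof.
move=> /andP[a0 a1].
rewrite [LHS](_ : _ = uniform_prob (@ltr01 R) [set x : R | x <= a]); last first.
  congr (uniform_prob _ _).
  apply/seteqP; split=> x /=; rewrite /seed_val /= ge_min ge_max a0 /=.
    by move=> /orP[//|]; rewrite leNgt a1.
  by move=> ->.
rewrite /uniform_prob integral_uniform_pdf.
rewrite (_ : _ `&` _ = `[0, a]%classic); last first.
  apply/seteqP; split=> x /=; rewrite !in_itv/=.
    by move=> [-> /andP[-> _]].
  by move=> /andP[-> xa]; split=> //; rewrite (le_trans xa)// ltW.
rewrite (eq_integral (cst 1%E)); last first.
  move=> x /set_mem; rewrite /= in_itv/= => /andP[x0 xa].
  by rewrite /uniform_pdf x0 (le_trans xa) ?(ltW a1)// subr0 invr1.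
rewrite integral_cst//= mul1e lebesgue_measure_itv/= lte_fin sube0.
by case: ltP => // a0'; congr EFin; apply/eqP; rewrite eq_le a0.
Qed.

Section holdout.
Context (R : realType) (dX dY dH : measure_display).
Context (X : measurableType dX) (Y : measurableType dY).
Context (Yh : measurableType dH).
Context (loss : {mfun (Yh * Y)%type >-> bool}) (n : nat).
Context (A : algorithm R X Y Yh).

(** The loss as a function of one batch, independently of its position in the
    data: the first [n] points train the model and the last one tests it. *)
Definition holdout_loss (w : n.+1.-tuple (X * Y) * seed R) : bool :=
  loss (A (take n w.1) w.2 (tnth w.1 ord_max).1, (tnth w.1 ord_max).2).

Lemma measurable_holdout_loss : measurable_fun setT holdout_loss.
Proof.
apply: measurableT_comp => //; apply: measurable_fun_pair => /=.
  (* The type of [take n w.1] as a tuple records the length [minn n n.+1]. *)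
  have -> : (fun w : n.+1.-tuple (X * Y) * seed R =>
      A (take n w.1) w.2 (tnth w.1 ord_max).1) =
    (fun w : (minn n n.+1).-tuple (X * Y) * seed R * X =>
       A w.1.1 w.1.2 w.2 : Yh)
    \o (fun w : n.+1.-tuple (X * Y) * seed R =>
          ([tuple of take n w.1], w.2, (tnth w.1 ord_max).1)) by [].
  apply: measurableT_comp; first exact: measurable_fit.
  apply: measurable_fun_pair => /=; last first.
    apply: measurableT_comp => //.
    by apply: (measurableT_comp (measurable_tnth _)).
  apply: measurable_fun_pair => //=.
  apply/measurable_fun_tnthP => i /=.
  have iS : (i < n.+1)%N.
    by rewrite (leq_trans (ltn_ord i))// geq_minr.
  rewrite (_ : _ \o _ = fun w => tnth w.1 (Ordinal iS)).
    by apply: (measurableT_comp (measurable_tnth _)).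
  apply/funext => w /=; rewrite !(tnth_nth point) /= nth_take//.
  by rewrite (leq_trans (ltn_ord i))// geq_minl.
apply: measurableT_comp => //.
by apply: (measurableT_comp (measurable_tnth _)).
Qed.

Lemma measurable_holdout_loss_event : measurable [set w | holdout_loss w].
Proof.
rewrite -[X in measurable X]setTI.
by apply: measurable_holdout_loss => //; exact: (_ : measurable [set true]).
Qed.

Lemma risk_holdout (P : probability (X * Y)%type R) :
  (iid_law P n.+1 \x unif_seed R)%E [set w | holdout_loss w] =
  (risk loss P n A)%:E.
Proof.
have mL := measurable_holdout_loss_event.
rewrite /risk (_ : (fun w => _) = \1_[set w | holdout_loss w]); last first.
  apply/funext => w; rewrite indicE; congr (_%:R); congr nat_of_bool.
  by apply/idP/idP => [|/set_mem]; [exact: mem_set|].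
by rewrite expectation_indic// fineK// fin_num_measure.
Qed.

Lemma risk_ge0_le1 (P : probability (X * Y)%type R) :
  0 <= risk loss P n A <= 1.
Proof.
rewrite -!lee_fin -risk_holdout measure_ge0/= probability_le1//.
exact: measurable_holdout_loss_event.
Qed.

(** Reading with a default value makes the batch a total function of the data,
    so that it can be composed with measurable maps. *)
Definition batch (D : seq (X * Y)) (j : nat) : n.+1.-tuple (X * Y) :=
  [tuple nth point D (j * n.+1 + i) | i < n.+1].

Lemma batch_lossE (D : seq (X * Y)) (xi : seed R) j :
  (j.+1 * n.+1 <= size D)%N ->
  batch_loss loss n A D xi j = holdout_loss (batch D j, xi).
Proof.
move=> jD; rewrite /batch_loss /holdout_loss /= !tnth_mktuple/=.
have jnD : (j * n.+1 + n < size D)%N by rewrite -addnS -mulSnr.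
rewrite (_ : take n (drop _ _) = take n (batch D j))//.
apply: (@eq_from_nth _ point) => [|i].
  rewrite !size_take size_drop size_tuple leqnn ifT//.
  by rewrite ltn_subRL.
rewrite size_take size_drop ifT ?ltn_subRL// => i_n.
rewrite !nth_take// nth_drop (nth_map ord0) ?size_enum_ord 1?ltnW//.
by rewrite nth_enum_ord// ltnW.
Qed.

End holdout.

(** * The binomial test is a black-box test *)

Section black_box.
Context (R : realType) (dX dY dH : measure_display).
Context (X : measurableType dX) (Y : measurableType dY).
Context (Yh : measurableType dH).
Variables (loss : {mfun (Yh * Y)%type >-> bool}) (alpha tau : R) (n : nat).
Implicit Types (A : algorithm R X Y Yh) (D : seq (X * Y)) (z : seed R).

Lemma measurable_batch N j :
  measurable_fun setT (fun D : N.-tuple (X * Y) => batch n D j).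
Proof.
apply/measurable_fun_tnthP => i.
have [iN|iN] := ltnP (j * n.+1 + i) N.
  rewrite (_ : _ \o _ = @tnth N _ ^~ (Ordinal iN)).
    exact: measurable_tnth.
  by apply/funext => D /=; rewrite tnth_mktuple (tnth_nth point).
rewrite (_ : _ \o _ = cst point)//.
by apply/funext => D /=; rewrite tnth_mktuple nth_default// size_tuple.
Qed.

Lemma measurable_binom_test :
  measurable_test (@binom_test R _ _ _ X Y Yh loss alpha tau n).
Proof.
move=> A N; case cutoff : (binom_cutoff alpha tau (N %/ n.+1)) => [k a].
pose s (w : N.-tuple (X * Y) * seed_seq R * seed R) :=
  (\sum_(j < N %/ n.+1) batch_loss loss n A w.1.1 (w.1.2 j) j)%N.
rewrite (_ : (fun w => _) =
    fun w => (s w < k)%N || (s w == k) && (seed_val w.2 <= a)); last first.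
  by apply/funext => w; rewrite /binom_test size_tuple cutoff.
have mS m : (m <= N %/ n.+1)%N -> measurable_fun setT
    (fun w : N.-tuple (X * Y) * seed_seq R * seed R =>
      (\sum_(j < m) batch_loss loss n A w.1.1 (w.1.2 j) j)%N).
  elim: m => [|m IH] mN.
    rewrite (_ : (fun w => _) = cst 0%N)//.
    by apply/funext => w; rewrite big_ord0.
  rewrite (_ : (fun w => _) = fun w : N.-tuple (X * Y) * seed_seq R * seed R =>
    (\sum_(j < m) batch_loss loss n A w.1.1 (w.1.2 j) j +
     batch_loss loss n A w.1.1 (w.1.2 m) m)%N); last first.
    by apply/funext => w; rewrite big_ord_recr.
  apply: measurable_fun_addn; first by apply: IH; exact: ltnW.
  apply: (@measurableT_comp _ _ _ _ _ _ nat_of_bool) => //.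
  rewrite (_ : (fun w => _) = @holdout_loss R _ _ _ X Y Yh loss n A \o
     (fun w : N.-tuple (X * Y) * seed_seq R * seed R =>
        (batch n w.1.1 m, w.1.2 m))).
    apply: measurableT_comp; first exact: measurable_holdout_loss.
    apply: measurable_fun_pair.
      by apply: (measurableT_comp (@measurable_batch N m));
        apply: measurableT_comp.
    have mz : measurable_fun setT (fun zs : seed_seq R => zs m : seed R).
      by move=> _ B mB; apply: sub_sigma_algebra; exists m => //; exists B.
    exact: (measurableT_comp mz
      (measurableT_comp measurable_snd measurable_fst)).
  apply/funext => w /=; rewrite batch_lossE// size_tuple.
  by rewrite (leq_trans (leq_mul mN (leqnn _)))// leq_trunc_div.
have {}mS : measurable_fun setT s := mS _ (leqnn _).
apply: measurable_or; first exact: measurable_fun_ltn.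
apply: measurable_and; first exact: measurable_fun_eqn.
apply: measurable_fun_ler => //.
apply: measurableT_comp => //.
move=> _ B mB; rewrite setTI; exists B => //.
by rewrite setTI.
Qed.

Definition binom_query : query_rule R X Y Yh :=
  fun r D _ zeta => (take n (drop (r * n.+1) D), zeta).

(** The losses are recomputed from the recorded models. Zipping with the batch
    numbers drops the dummy round that is run when there is no batch. *)
Definition binom_output D (past : seq (round R X Y Yh)) z : bool :=
  let m := (size D %/ n.+1)%N in
  let s := (\sum_(p <- zip (iota 0 m) past)
    let test := nth point D (p.1 * n.+1 + n) in
    loss (round_model p.2 test.1, test.2))%N in
  let: (k, a) := binom_cutoff alpha tau m in
  (s < k)%N || (s == k) && (seed_val z <= a).

Lemma rounds_binom_query A D zs r :
  rounds A binom_query D zs r =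
  [seq Round (take n (drop (j * n.+1) D)) (zs j)
         (A (take n (drop (j * n.+1) D)) (zs j)) (zs j) | j <- iota 0 r].
Proof.
elim: r => // r IH; rewrite -addn1 iotaD map_cat -IH add0n addn1 /=.
by rewrite cats1.
Qed.

Lemma black_box_binom_test :
  black_box_test (@binom_test R _ _ _ X Y Yh loss alpha tau n).
Proof.
split; last exact: measurable_binom_test.
exists binom_query,
  (fun D past => (maxn (size D %/ n.+1) 1 <= size past)%N), binom_output.
move=> A D zs z; pose m := (size D %/ n.+1)%N.
have sr r : size (rounds A binom_query D zs r) = r.
  by rewrite rounds_binom_query size_map size_iota.
exists (maxn m 1); split; first by rewrite leq_max orbT.
  by rewrite sr.
  by move=> r /andP[_]; rewrite sr -ltnNge.
rewrite /binom_test /binom_output -/m.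
set s := (\sum_(j < m) _)%N; set s' := (\sum_(p <- _) _)%N.
suff -> : s = s' by [].
rewrite {}/s {}/s' rounds_binom_query.
case: m => [|m]; first by rewrite big_ord0 big_nil.
rewrite (maxn_idPl _)//.
rewrite -{1}(map_id (iota 0 m.+1)) zip_map big_map.
rewrite -(big_mkord xpredT
  (fun j => nat_of_bool (batch_loss loss n A D (zs j) j))).
by rewrite /index_iota subn0.
Qed.

End black_box.

(** * The level of the binomial test *)

Section level.
Context (R : realType) (dX dY dH : measure_display).
Context (X : measurableType dX) (Y : measurableType dY).
Context (Yh : measurableType dH).
Variables (loss : {mfun (Yh * Y)%type >-> bool}) (alpha tau : R) (n N : nat).
Variables (A : algorithm R X Y Yh) (P : probability (X * Y)%type R).
Variables (dO : measure_display) (Omega : measurableType dO).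
Variables (Pr : probability Omega R) (Z : 'I_N -> {RV Pr >-> (X * Y)%type}).
Variables (zs : nat -> {RV Pr >-> seed R}) (z : {RV Pr >-> seed R}).
Hypothesis model : sampling_model P Z zs z.

Let F := sources Z zs z.

Lemma measurable_sources i : F i `<=` measurable.
Proof. by case: i => [i|[r|]] _ [B mB <-]; exact: measurable_funPT. Qed.

(** The sources left after [j] batches. The final seed is never consumed by a
    batch, and the incomplete last batch stays unused. *)
Definition unused_from (j : nat) : set ('I_N + option nat) :=
  fun i => match i with
           | inl k => (j * n.+1 <= k)%N
           | inr (Some r) => (j <= r)%N
           | inr None => True
           end.

Lemma indep_law_batch j : (j < N %/ n.+1)%N ->
  indep_law Pr F (unused_from j `\` unused_from j.+1)
    (fun w => (batch n [tuple Z i w | i < N] j, zs j w))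
    (iid_law P n.+1 \x unif_seed R)%E.
Proof.
move=> jm.
have jN (i : 'I_n.+1) : (j * n.+1 + i < N)%N.
  apply: (@leq_trans (j.+1 * n.+1)); first by rewrite mulSnr ltn_add2l.
  by rewrite (leq_trans (leq_mul jm (leqnn _)))// leq_trunc_div.
pose idx (i : 'I_n.+1) : 'I_N := Ordinal (jN i).
have -> : (fun w => (batch n [tuple Z i w | i < N] j, zs j w)) =
    (fun w => ([tuple Z (idx i) w | i < n.+1], zs j w)).
  apply/funext => w; congr (_, _); apply: eq_from_tnth => i.
  rewrite !tnth_mktuple -[RHS](tnth_mktuple (fun k => Z k w) (idx i)).
  by rewrite (tnth_nth point).
suff : indep_law Pr F
    (\bigcup_i [set (inl (idx i) : 'I_N + option nat)] `|` [set inr (Some j)])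
    (fun w => ([tuple Z (idx i) w | i < n.+1], zs j w))
    (iid_law P n.+1 \x unif_seed R)%E.
  apply: indep_lawS => _ [[i _ ->]|->] /=.
    split; first exact: leq_addr.
    by apply/negP; rewrite -ltnNge mulSnr ltn_add2l.
  by split=> //; apply/negP; rewrite -ltnNge.
apply: indep_law_pair.
- exact: measurable_sources.
- by rewrite -subset0 => x [[i _ ->]].
- apply: indep_law_tuple; first exact: measurable_sources.
    move=> i i' _ _ [_ [/= -> []]] => /addnI ii'; exact: val_inj.
  move=> i; apply: indep_law_source; first exact: measurable_sources.
    by [].
  exact: (data_law model).
- apply: indep_law_source; first exact: measurable_sources.
    by [].
  exact: (seeds_law model).
Qed.

Let r := risk loss P n A.
Let m := (N %/ n.+1)%N.

(** The test rejects when S < k or when S = k and zeta <= a. The event S = k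
    only involves the batches, so it is independent of zeta, and the second case
    has probability a * P(S = k). *)
Lemma rejection_probE ka : binom_cutoff alpha tau m = ka -> 0 <= ka.2 < 1 ->
  rejection_prob (binom_test loss alpha tau n) A Z zs z =
  (rejection_level m r ka)%:E.
Proof.
case: ka => k a cutoff /= a01.
pose L j w := holdout_loss loss A (batch n [tuple Z i w | i < N] j, zs j w).
have indep0 : indep_event Pr F (unused_from 0) setT.
  by apply: indep_eventS (indep_eventT (sources_independent model)) => // i.
have dec j : (j < m)%N -> unused_from j.+1 `<=` unused_from j.
  move=> _ [i|[i|//]] /=; last exact: ltnW.
  by apply: leq_trans; rewrite leq_mul2r leqnSn orbT.
have indepL j E : (j < m)%N -> indep_event Pr F (unused_from j) E ->
    indep_event Pr F (unused_from j.+1) (E `&` [set w | L j w]) /\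
    Pr (E `&` [set w | L j w]) = (Pr E * r%:E)%E.
  move=> jm indE; have lawL := indep_law_batch jm.
  have mL := @measurable_holdout_loss_event R _ _ _ X Y Yh loss n A.
  split.
    have := indep_eventI measurable_sources lawL (@subDsetl _ _ _) mL indE.
    apply: indep_eventS => i Ki; split; first exact: dec Ki.
    by case.
  rewrite /r -risk_holdout; apply: (lawL.2 E _ _ mL).
  by apply: indep_eventS indE; exact: subDsetl.
have Seq := indep_count_eq measurable_sources indep0 dec indepL k (leqnn m).
have Slt := prob_count_lt measurable_sources indep0 dec indepL k.
have lawz : indep_law Pr F [set inr None] z (unif_seed R).
  apply: indep_law_source => //; first exact: measurable_sources.
  exact: (final_seed_law model).
have ma : measurable [set u : seed R | seed_val u <= a].
  exists `]-oo, a]%classic => //; rewrite setTI.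
  by apply/seteqP; split=> u /=; rewrite in_itv.
have Sle : Pr ([set w | (\sum_(i < m) L i w)%N = k] `&`
      z @^-1` [set u | seed_val u <= a]) = (a * binomial_pmf m r k)%:E.
  rewrite lawz.2// ?Seq.2 ?unif_seed_le// -?EFinM 1?mulrC//.
  by apply: indep_eventS Seq.1 => i ->.
rewrite /rejection_prob (_ : [set w | _] =
  [set w | (\sum_(i < m) L i w < k)%N] `|`
  ([set w | (\sum_(i < m) L i w)%N = k] `&` z @^-1` [set u | seed_val u <= a])).
  rewrite measureU//.
  - by rewrite [X in (X + _)%E]Slt.2 [X in (_ + X)%E]Sle -EFinD.
  - exact: Slt.1.
  - apply: measurableI; first exact: Seq.1.1.
    by rewrite -[X in measurable X]setTI; exact: measurable_funPT.
  - by rewrite -subset0 => w [/= + [/= Sk _]]; rewrite Sk ltnn.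
have testE w : binom_test loss alpha tau n A [tuple Z i w | i < N]
      (fun r => zs r w) (z w) =
    (\sum_(i < m) L i w < k)%N ||
    ((\sum_(i < m) L i w)%N == k) && (seed_val (z w) <= a).
  rewrite /binom_test size_tuple -/m cutoff.
  suff -> : (\sum_(j < m) batch_loss loss n A [tuple Z i w | i < N] (zs j w) j =
     \sum_(i < m) L i w)%N by [].
  apply: eq_bigr => j _; rewrite batch_lossE// size_tuple.
  by rewrite (leq_trans (leq_mul (ltn_ord j) (leqnn _)))// leq_trunc_div.
apply/seteqP; split=> w; rewrite /= testE.
  by move=> /orP[|/andP[/eqP]]; [left|right].
by move=> [->//|[/eqP -> ->]]; rewrite orbT.
Qed.

End level.

(** * Validity and power of the binomial test *)

Theorem theorem2 (R : realType) (dX dY dH : measure_display)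
    (X : measurableType dX) (Y : measurableType dY) (Yh : measurableType dH)
    (loss : {mfun (Yh * Y)%type >-> bool}) (alpha tau : R) (n N : nat)
    (alpha01 : 0 < alpha < 1) (tau01 : 0 < tau < 1)
    (n_ge1 : (1 <= n)%N) (N_ge1 : (1 <= N)%N) :
  let T : randomized_test R X Y Yh := binom_test loss alpha tau n in
  [/\ black_box_test T,
      valid_test loss alpha tau n N T
    & alpha < (1 - tau) ^+ (N %/ n.+1) ->
      forall (A : algorithm R X Y Yh) (P : probability (X * Y)%type R),
        risk loss P n A < tau ->
      forall (dO : measure_display) (Omega : measurableType dO)
        (Pr : probability Omega R) (Z : 'I_N -> {RV Pr >-> (X * Y)%type})
        (zs : nat -> {RV Pr >-> seed R}) (z : {RV Pr >-> seed R}),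
        sampling_model P Z zs z ->
        rejection_prob T A Z zs z =
          (Num.min (alpha * (1 + (tau - risk loss P n A) / (1 - tau))
                              ^+ (N %/ n.+1)) 1)%:E].
Proof.
move=> T; set m := (N %/ n.+1)%N.
have /andP[tau_gt0 tau_lt1] := tau01.
have /andP[alpha_gt0 alpha_lt1] := alpha01.
have tau_ge0le1 : 0 <= tau <= 1 by rewrite !ltW.
have cutoff := binom_cutoff_spec m alpha01 tau01.
have /is_binom_cutoffE[//|a01 level_tau] := cutoff.
split.
- exact: black_box_binom_test.
- move=> A P tau_risk dO Omega Pr Z zs z model.
  rewrite (rejection_probE loss A model erefl)// lee_fin -[leRHS]level_tau.
  apply: rejection_level_nonincreasing => //; first exact: ltW.
  by have /andP[] := risk_ge0_le1 loss n A P.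
move=> alpha_small A P risk_tau dO Omega Pr Z zs z model.
(* Here the cutoff is explicit: k = 0 already gives P(S = 0) > alpha at tau,
   so that a only has to scale (1 - tau) ^ m down to alpha. *)
have q_gt0 : 0 < 1 - tau by rewrite subr_gt0.
have qm_gt0 : 0 < (1 - tau) ^+ m by rewrite exprn_gt0.
set a := alpha / (1 - tau) ^+ m.
have a01' : 0 <= a < 1 by rewrite divr_ge0 ?ltW//= ltr_pdivrMr// mul1r.
have cutoffE : binom_cutoff alpha tau m = (0%N, a).
  apply: (binom_cutoff_uniq alpha01 tau01 cutoff).
  apply/is_binom_cutoffE => //; split=> //.
  rewrite /rejection_level binomial_cdf0 add0r /= binomial_pmf0.
  by rewrite divfK ?gt_eqF.
rewrite (rejection_probE loss A model cutoffE)//; congr EFin.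
rewrite /rejection_level binomial_cdf0 add0r /= binomial_pmf0.
have /andP[risk_ge0 risk_le1] := risk_ge0_le1 loss n A P.
set r := risk loss P n A in risk_tau risk_ge0 risk_le1 *.
have -> : 1 + (tau - r) / (1 - tau) = (1 - r) / (1 - tau).
  by field; rewrite gt_eqF.
rewrite expr_div_n /a mulrAC -mulrA min_l// mulrA mulrAC -/a.
rewrite mulr_ile1 ?exprn_ge0 ?subr_ge0//; first by case/andP: a01'.
  by case/andP: a01' => _ /ltW.
by rewrite exprn_ile1 ?subr_ge0// lerBlDr lerDl.
Qed.
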